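(* Let $P=\{\boldsymbol{x}_0,\dots,\boldsymbol{x}_{b^m-1}\}\subset\mathbb{R}^s$ be constructed as described in the context from a digital $(t,m,s)$-net over $\mathbb{Z}_b$. For $\boldsymbol{d}=(d_1,\dots,d_s)\in\prod_{i=1}^s\{1,\dots,\Delta_i\}$ let $$m_{\boldsymbol{d}}=m-\sum_{i=1}^s(m-m_{i,d_i}),\qquad J_{\boldsymbol{d}}=\prod_{i=1}^sJ_{i,d_i}.$$ Then for each $\boldsymbol{d}\in\prod_{i=1}^s\{1,\dots,\Delta_i\}$ with $m_{\boldsymbol{d}}\ge t$, the points of $P$ that lie in $J_{\boldsymbol{d}}$ form a digitally shifted digital $(t,m_{\boldsymbol{d}},s)$-net over $\mathbb{Z}_b$ in $J_{\boldsymbol{d}}$. In particular, for all such $\boldsymbol{d}$ the box $J_{\boldsymbol{d}}$ contains at least one point of $P$.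
   Context: Let $b\ge2$ be a prime, $\mathbb{Z}_b$ the field with $b$ elements (identified with $\{0,\dots,b-1\}$ when forming integers), $s\ge1$, $m\ge1$. Construction. For $1\le i\le s$ and $1\le d\le\Delta_i$ let $J_{i,d}=[b^{j_{i,d}}l_{i,d},b^{j_{i,d}}(l_{i,d}+1))$ with $j_{i,d},l_{i,d}\in\mathbb{Z}$, where for each $i$ the intervals $J_{i,1},\dots,J_{i,\Delta_i}$ are pairwise disjoint. Let $0\le m_{i,\Delta_i}\le\cdots\le m_{i,2}\le m_{i,1}\le m$ be integers with $b^{m_{i,1}}+\cdots+b^{m_{i,\Delta_i}}=b^m$. For each $i$ define labelled points $z^{(i)}_0,\dots,z^{(i)}_{b^m-1}\in\mathbb{R}$ by $$z^{(i)}_{b^{m_{i,1}}+\cdots+b^{m_{i,d-1}}+k}=b^{j_{i,d}}l_{i,d}+k\,b^{j_{i,d}-m_{i,d}},\qquad 1\le d\le\Delta_i,\ 0\le k<b^{m_{i,d}},$$ (for $d=1$ the sum $b^{m_{i,1}}+\cdots+b^{m_{i,d-1}}$ is $0$). Let $C_1,\dots,C_s\in\mathbb{Z}_b^{m\times m}$ be the generating matrices of a digital $(t,m,s)$-net over $\mathbb{Z}_b$, i.e. for all integers $e_1,\dots,e_s\ge0$ with $e_1+\cdots+e_s=m-t$ the first $e_i$ rows of $C_i$, $1\le i\le s$, are altogether linearly independent over $\mathbb{Z}_b$. For $0\le n<b^m$, $n=n_0+n_1b+\cdots+n_{m-1}b^{m-1}$, let $(\eta_{n,i,0},\dots,\eta_{n,i,m-1})^\top=C_i(n_0,\dots,n_{m-1})^\top$,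 $\eta_{n,i}=\eta_{n,i,0}b^{m-1}+\eta_{n,i,1}b^{m-2}+\cdots+\eta_{n,i,m-1}$, $x_{n,i}=z^{(i)}_{\eta_{n,i}}$ and $\boldsymbol{x}_n=(x_{n,1},\dots,x_{n,s})$. Nets in boxes. A digitally shifted digital $(t,m,s)$-net over $\mathbb{Z}_b$ (with $0\le t\le m$) is a point set $\{\boldsymbol{y}_0,\dots,\boldsymbol{y}_{b^m-1}\}\subset[0,1)^s$ for which there are matrices $C_1,\dots,C_s$ over $\mathbb{Z}_b$ with $m$ columns and rows indexed by $1,2,\dots$ (an $m\times m$ matrix is extended by zero rows) and shifts $\sigma_i=(\sigma_{i,1},\sigma_{i,2},\dots)$ over $\mathbb{Z}_b$ such that, for $0\le n<b^m$ with digit vector $\vec{n}\in\mathbb{Z}_b^m$, the $k$-th base $b$ digit of the $i$-th coordinate of $\boldsymbol{y}_n$ is the $k$-th entry of $C_i\vec{n}+\sigma_i$ (base $b$ expansions with infinitely many digits different from $b-1$), and such that for all $e_1,\dots,e_s\ge0$ with $e_1+\cdots+e_s=m-t$ the first $e_i$ rows of $C_i$, $1\le i\le s$, are altogether linearly independent. A point set in $J=\prod_{i=1}^s[b^{j_i}l_i,b^{j_i}(l_i+1))$, $j_i,l_i\in\mathbb{Z}$, is a digitally shifted digital $(t,m,s)$-net over $\mathbb{Z}_b$ in $J$ if its image under $\boldsymbol{x}\mapsto(b^{-j_i}x_i-l_i)_{i=1}^s$ is a digitally shifted digital $(t,m,s)$-net over $\mathbb{Z}_b$ (the enumeration of the points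 is irrelevant). *)

(* Defs.v *)
From mathcomp Require Import all_boot all_order all_algebra.
From mathcomp Require Import boolp classical_sets reals topology normedtype.
From mathcomp Require Import sequences.

Set Implicit Arguments.
Unset Strict Implicit.
Unset Printing Implicit Defensive.

Import Order.TTheory GRing.Theory Num.Theory.
Import numFieldNormedType.Exports.
Local Open Scope ring_scope.
Local Open Scope classical_set_scope.

(* All indices (rows, digits, coordinates, intervals) start at 0.
   The base b is meant to be prime, so that 'F_b has b elements and its
   elements, seen as naturals, range over 0, ..., b - 1.
   A point set is a finite multiset of points, represented by a sequence of
   row vectors up to perm_eq: distinct labels may carry equal points. *)

Section Digits.

Variables (R : realType) (b : nat).

Definition digit_vec (m n : nat) : 'cV['F_b]_m :=
  \col_(k < m) ((n %/ b ^ k) %% b)%:R.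

(* The base b expansion of y with infinitely many digits different from b - 1;
   c k is the digit of weight b ^ -(k + 1). *)
Definition is_expansion (c : nat -> nat) (y : R) : Prop :=
  [/\ forall k, (c k < b)%N,
      forall N, exists2 k, (N <= k)%N & c k != b.-1
    & series (fun k => (c k)%:R / b%:R ^+ k.+1 : R) @ \oo --> y].

End Digits.

Section Nets.

Variables (R : realType) (b t m s : nat).

(* A matrix with m columns and rows indexed by nat is the function giving its
   rows. *)
Definition zero_extend (A : 'M['F_b]_m) (k : nat) : 'rV['F_b]_m :=
  if insub k is Some i then row i A else 0.

Definition generates_net (C : 'I_s -> nat -> 'rV['F_b]_m) : Prop :=
  (t <= m)%N /\
  forall e : 'I_s -> nat, (\sum_i e i = m - t)%N ->
    free [seq C i k | i <- enum 'I_s, k <- iota 0 (e i)].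

Definition shifted_digital_net (Y : seq 'rV[R]_s) : Prop :=
  exists (C : 'I_s -> nat -> 'rV['F_b]_m) (sigma : 'I_s -> nat -> 'F_b)
         (y : nat -> 'rV[R]_s),
  [/\ generates_net C,
      forall n i, (n < b ^ m)%N ->
        0 <= y n 0 i < 1 /\
        is_expansion b
          (fun k => nat_of_ord ((C i k *m digit_vec b m n) 0 0 + sigma i k))
          (y n 0 i)
    & perm_eq Y [seq y n | n <- iota 0 (b ^ m)]].

End Nets.

Section Boxes.

Variables (R : realType) (b : nat).

Definition badic_itv (j l : int) : interval R :=
  `[b%:R ^ j * l%:~R, b%:R ^ j * (l + 1)%:~R[%R.

Definition in_box (s : nat) (j l : 'I_s -> int) (x : 'rV[R]_s) : bool :=
  [forall i, x 0 i \in badic_itv (j i) (l i)].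

Definition box_to_unit (s : nat) (j l : 'I_s -> int) (x : 'rV[R]_s) :
    'rV[R]_s :=
  \row_i (b%:R ^ (- j i) * x 0 i - (l i)%:~R).

Definition shifted_digital_net_in_box (t m s : nat) (j l : 'I_s -> int)
    (Y : seq 'rV[R]_s) : Prop :=
  all (in_box j l) Y /\
  shifted_digital_net b t m [seq box_to_unit j l x | x <- Y].

End Boxes.

Section Construction.

Variables (R : realType) (b m s : nat).

(* Row 0 of A yields the most significant digit. *)
Definition net_index (A : 'M['F_b]_m) (n : nat) : nat :=
  (\sum_(k < m)
     nat_of_ord ((A *m digit_vec b m n) k ord0) * b ^ (m - k.+1))%N.

(* One coordinate; since the b ^ mu d sum to b ^ m, this determines z h for
   every h < b ^ m. *)
Definition labelled_points (D : nat) (j l : 'I_D -> int) (mu : 'I_D -> nat)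
    (z : nat -> R) : Prop :=
  forall (d : 'I_D) (k : nat), (k < b ^ mu d)%N ->
    z ((\sum_(d' < D | (d' < d)%N) b ^ mu d') + k)%N
    = b%:R ^ j d * (l d)%:~R + k%:R * b%:R ^ (j d - (mu d)%:Z).

Definition net_point (z : 'I_s -> nat -> R) (C : 'I_s -> 'M['F_b]_m)
    (n : nat) : 'rV[R]_s :=
  \row_i z i (net_index (C i) n).

End Construction.

(* Main.v *)
Require Import Defs.
From mathcomp Require Import all_boot all_order all_algebra.
From mathcomp Require Import boolp classical_sets reals topology normedtype.
From mathcomp Require Import sequences.

Set Implicit Arguments.
Unset Strict Implicit.
Unset Printing Implicit Defensive.

Import Order.TTheory GRing.Theory Num.Theory.
Import numFieldNormedType.Exports.
Local Open Scope ring_scope.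
Local Open Scope classical_set_scope.


(** In the i-th coordinate the labels of the points in J_{i,d_i} are the numbers
    whose first r_i = m - m_{i,d_i} base b digits are prescribed, because the
    m_{i,d} are nonincreasing and so the block of labels of J_{i,d_i} starts at
    a multiple of b^(m_{i,d_i}).  Hence x_n lies in J_d iff the digit vector of
    n solves a linear system whose rows are the first r_i rows of the C_i.
    These sum r_i = m - m_d <= m - t rows are independent, so the solutions are
    v0 + Z u with u in F_b^(m_d).  The remaining digits of the labels are those
    of the points in the box: they are given by the rows of index >= r_i of C_i
    multiplied by Z, with shift coming from v0.  A row vector killed by Z lies
    in the span of the first rows, so independence passes to these products. *)

(** * Linear algebra: solution sets of independent systems *)

(** Stacking [A] on a basis [B] of a complement of its row space gives an invertible square matrix;
    [N] and [Z] are the column blocks of its inverse. The four identities are the blocks of the two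
    products of these inverse matrices. *)
Lemma row_free_complement (K : fieldType) (p q : nat) (A : 'M[K]_(p, p + q)) :
  row_free A ->
  exists (B : 'M[K]_(q, p + q)) (N : 'M[K]_(p + q, p)) (Z : 'M[K]_(p + q, q)),
  [/\ A *m N = 1%:M, A *m Z = 0, B *m Z = 1%:M & N *m A + Z *m B = 1%:M].
Proof.
move=> /eqP rA.
have rAC : \rank (A^C)%MS = q by rewrite mxrank_compl rA addKn.
have [B eqB] : exists B : 'M[K]_(q, p + q), (B :=: A^C)%MS.
  have := eq_row_base (A^C)%MS; move: (row_base _); rewrite rAC => B.
  by exists B.
have fullAB : row_full (col_mx A B).
  rewrite -sub1mx -addsmxE (adds_eqmx (eqmx_refl A) eqB) sub1mx.
  exact: addsmx_compl_full.
have [X /= XAB] := row_fullP fullAB.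
have ABX := mulmx1C XAB.
exists B, (lsubmx X), (rsubmx X).
move: XAB ABX; rewrite -{1 2}(hsubmxK X) mul_row_col mul_col_row.
rewrite scalar_mx_block => XAB /eq_block_mx[-> -> _ ->]; split=> //.
Qed.

Lemma free_row_free (K : fieldType) (m : nat) (T : eqType) (x0 : T)
    (I : seq T) (F : T -> 'rV[K]_m) :
  free [seq F x | x <- I] ->
  row_free (\matrix_(h < size I) F (nth x0 I h)).
Proof.
move=> freeI; apply: inj_row_free => v; rewrite mulmx_sum_row => v0.
have /freeP fI : free (map_tuple F (in_tuple I)) by [].
apply/rowP => h; rewrite mxE; apply: (fI (fun h => v 0 h)).
rewrite -[RHS]v0; apply: eq_bigr => i _.
by rewrite rowK (nth_map x0).
Qed.

(** With [A] the matrix of the rows [F x] and [N], [Z], [B] as above, [v0] is [N] times the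
    right-hand side, and any solution [v] is N (A v) + Z (B v). If w Z = 0, then w = (w N) A is a
    combination of the rows of [A]. *)
Lemma free_affine_solutions (K : fieldType) (m q : nat) (T : eqType)
    (I : seq T) (F : T -> 'rV[K]_m) (a : T -> K) :
  free [seq F x | x <- I] -> (size I + q)%N = m ->
  exists (v0 : 'cV[K]_m) (Z : 'M[K]_(m, q)),
  [/\ injective (fun u : 'cV[K]_q => v0 + Z *m u),
      forall v : 'cV[K]_m, (forall x, x \in I -> (F x *m v) 0 0 = a x) <->
         exists u, v = v0 + Z *m u
    & forall w : 'rV[K]_m, w *m Z = 0 -> w \in <<[seq F x | x <- I]>>%VS].
Proof.
move=> freeI em.
(* The empty system is treated apart, since [nth] needs a default label [x0]. *)
have [I0|[x0 _]] : I = [::] \/ exists x0, x0 \in I.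
  by case: (I) => [|x0 ?]; [left|right; exists x0; rewrite mem_head].
  move: freeI em; rewrite I0 add0n => _ em; subst m.
  exists 0, 1%:M; split=> [u v||w].
  - by rewrite !mul1mx !add0r.
  - move=> v; split=> [_|_ x]; last by rewrite in_nil.
    by exists v; rewrite mul1mx add0r.
  - by rewrite mulmx1 => ->; rewrite mem0v.
subst m.
have rfA := free_row_free x0 freeI.
set A := \matrix_h _ in rfA.
have [B [N [Z [AN AZ BZ NAZB]]]] := row_free_complement rfA.
have AE v : (forall x, x \in I -> (F x *m v) 0 0 = a x) <->
    A *m v = \col_h a (nth x0 I h).
  have rowA h : (A *m v) h 0 = (F (nth x0 I h) *m v) 0 0.
    by rewrite -(rowK (fun h => F (nth x0 I h)) h) -row_mul [RHS]mxE.
  split=> [Fv|Av x xI].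
    by apply/colP => h; rewrite rowA [RHS]mxE; apply/Fv/mem_nth.
  have hI : (index x I < size I)%N by rewrite index_mem.
  have := congr1 (fun w : 'cV_ _ => w (Ordinal hI) 0) Av.
  by rewrite rowA [RHS]mxE /= nth_index.
exists (N *m \col_h a (nth x0 I h)), Z; split.
- by move=> u v /addrI /(congr1 (mulmx B)); rewrite !mulmxA BZ !mul1mx.
- move=> v; rewrite AE; split=> [Av|[u ->]].
    by exists (B *m v); rewrite -Av !mulmxA -mulmxDl NAZB mul1mx.
  by rewrite mulmxDr !mulmxA AN AZ mul1mx mul0mx addr0.
- move=> w wZ; rewrite -[w]mulmx1 -NAZB mulmxDr !mulmxA wZ mul0mx addr0.
  rewrite mulmx_sum_row; apply: memv_suml => h _; apply: memvZ.
  by rewrite rowK; apply/memv_span/map_f/mem_nth.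
Qed.

(** The kernel of right multiplication by [Z] lies in the span of [X], which meets the span of [Y]
    only in 0. So this map is injective on the span of [Y] and preserves the independence of [Y]. *)
Lemma free_mulmxr (K : fieldType) (m q : nat) (X Y : seq 'rV[K]_m)
    (Z : 'M[K]_(m, q)) :
  (forall w : 'rV[K]_m, w *m Z = 0 -> w \in <<X>>%VS) ->
  free (X ++ Y) -> free [seq w *m Z | w <- Y].
Proof.
move=> kerZ; rewrite cat_free => /and3P[_ freeY /directv_addP XY0].
have -> : [seq w *m Z | w <- Y] = map (linfun (mulmxr Z)) Y.
  by apply: eq_map => w; rewrite lfunE.
apply: (@basis_free _ _ (linfun (mulmxr Z) @: <<Y>>)%VS).
apply: limg_basis_of; last by rewrite basisEfree freeY subvv /= dim_span.
apply/eqP; rewrite -subv0 -XY0 subv_cap capvSl andbT.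
apply/subvP => w /memv_capP[_]; rewrite memv_ker lfunE /= => /eqP.
exact: kerZ.
Qed.

(* Most significant digit first, as in [net_index]. *)
Definition from_digits (b r : nat) (w : nat -> nat) : nat :=
  (\sum_(k < r) w k * b ^ (r - k.+1))%N.

Definition nth_digit (b r n k : nat) : nat := (n %/ b ^ (r - k.+1) %% b)%N.

(** * Base b digits of integers and of b-adic fractions *)

Section FromDigits.

Variable b : nat.
Hypothesis b_gt1 : (1 < b)%N.

Let b_gt0 : (0 < b)%N := ltnW b_gt1.

Lemma eq_from_digits r (w w' : nat -> nat) :
  (forall k, (k < r)%N -> w k = w' k) -> from_digits b r w = from_digits b r w'.
Proof. by move=> eqw; apply: eq_bigr => k _; rewrite eqw. Qed.

(** This separates the leading digits, which select a block of labels, from the trailing ones, which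
    give the position in the block. *)
Lemma from_digits_add r mu (w : nat -> nat) :
  from_digits b (r + mu) w
  = (from_digits b r w * b ^ mu + from_digits b mu (fun k => w (r + k)))%N.
Proof.
rewrite /from_digits big_split_ord /= big_distrl /=; congr (_ + _)%N.
  apply: eq_bigr => k _; rewrite -mulnA -expnD; congr (_ * b ^ _)%N.
  by rewrite addnBAC.
by apply: eq_bigr => k _; rewrite -addnS subnDl.
Qed.

Lemma from_digitsS r (w : nat -> nat) :
  from_digits b r.+1 w = (from_digits b r w * b + w r)%N.
Proof.
rewrite -addn1 from_digits_add expn1 /from_digits big_ord1 /=.
by rewrite addn0 subnn muln1.
Qed.

Lemma from_digits_lt r (w : nat -> nat) :
  (forall k, (w k < b)%N) -> (from_digits b r w < b ^ r)%N.
Proof.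
move=> wb; elim: r => [|r IHr]; first by rewrite /from_digits big_ord0.
rewrite from_digitsS expnSr -addnS.
apply: (@leq_trans ((from_digits b r w).+1 * b)); last first.
  by rewrite leq_mul2r IHr orbT.
by rewrite mulSn addnC leq_add2r wb.
Qed.

Lemma nth_digit_div r n k : (k < r)%N ->
  nth_digit b r.+1 n k = nth_digit b r (n %/ b) k.
Proof. by move=> kr; rewrite /nth_digit subSS -(subnSK kr) expnS divnMA. Qed.

Lemma from_nth_digit r n : (n < b ^ r)%N ->
  from_digits b r (nth_digit b r n) = n.
Proof.
elim: r n => [|r IHr] n; first by rewrite /from_digits big_ord0; case: n.
move=> nb; rewrite from_digitsS [nth_digit _ _ _ r]/nth_digit subnn divn1.
rewrite [RHS](divn_eq n b); congr (_ * _ + _)%N.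
rewrite -[RHS]IHr ?ltn_divLR -?expnSr //.
by apply: eq_from_digits => k; apply: nth_digit_div.
Qed.

Lemma nth_from_digits r (w : nat -> nat) k : (forall k, (w k < b)%N) ->
  (k < r)%N -> nth_digit b r (from_digits b r w) k = w k.
Proof.
move=> wb; elim: r => // r IHr; rewrite ltnS leq_eqVlt => /predU1P[->|kr].
  by rewrite from_digitsS /nth_digit subnn divn1 modnMDl modn_small.
rewrite nth_digit_div // from_digitsS divnMDl // divn_small // addn0.
exact: IHr.
Qed.

Lemma from_digitsP r (w : nat -> nat) n : (forall k, (w k < b)%N) ->
  (n < b ^ r)%N ->
  from_digits b r w = n <-> (forall k, (k < r)%N -> w k = nth_digit b r n k).
Proof.
move=> wb nb; split=> [<- k kr|wE]; first by rewrite nth_from_digits.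
by rewrite (eq_from_digits wE) from_nth_digit.
Qed.

Lemma from_digits_div r mu (w : nat -> nat) : (forall k, (w k < b)%N) ->
  (from_digits b (r + mu) w %/ b ^ mu)%N = from_digits b r w.
Proof.
move=> wb; rewrite from_digits_add divnMDl ?expn_gt0 ?b_gt0 //.
by rewrite divn_small ?addn0 // from_digits_lt.
Qed.

Lemma from_digits_mod r mu (w : nat -> nat) : (forall k, (w k < b)%N) ->
  (from_digits b (r + mu) w %% b ^ mu)%N
  = from_digits b mu (fun k => w (r + k)).
Proof.
by move=> wb; rewrite from_digits_add modnMDl modn_small // from_digits_lt.
Qed.

(** The partial sums are constant from index [mu] on. The digits there are 0, hence different from b
    - 1 because b > 1. *)
Lemma is_expansion_from_digits (R : realType) mu (c : nat -> nat) :
  (forall k, (c k < b)%N) -> (forall k, (mu <= k)%N -> c k = 0) ->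
  is_expansion b c ((from_digits b mu c)%:R / b%:R ^+ mu : R).
Proof.
move=> cb c0; split=> // [N|].
  exists (maxn N mu); first exact: leq_maxl.
  by rewrite c0 ?leq_maxr // eq_sym -lt0n -subn1 subn_gt0.
apply: cvg_near_cst; exists mu => // N /= muN.
have b0 : b%:R != 0 :> R by rewrite pnatr_eq0 -lt0n.
rewrite /series /= (big_cat_nat (leq0n mu) muN) //= [X in _ + X]big1_seq; last first.
  move=> k; rewrite mem_index_iota => /andP[_ /andP[/c0 -> _]].
  by rewrite mul0r.
rewrite addr0 big_mkord natr_sum mulr_suml; apply: eq_bigr => k _.
rewrite natrM natrX -mulrA; congr (_ * _).
have -> : b%:R ^+ mu = b%:R ^+ (mu - k.+1) * b%:R ^+ k.+1 :> R.
  by rewrite -exprD subnK.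
by rewrite invfM mulVKf // expf_neq0.
Qed.

End FromDigits.

(** * Digit vectors over the field with b elements *)

Section DigitVec.

Variable b : nat.
Hypothesis b_prime : prime b.

Let b_gt1 : (1 < b)%N := prime_gt1 b_prime.

Lemma ltn_Fp (x : 'F_b) : (x < b)%N.
Proof. by rewrite -[X in (_ < X)%N](Fp_cast b_prime) ltn_ord. Qed.

(** The digits determine n < b^m, and there are exactly b^m vectors, so injectivity gives
    bijectivity. *)
Lemma digit_vec_bij m : exists num : 'cV['F_b]_m -> nat,
  [/\ forall v, (num v < b ^ m)%N, cancel num (digit_vec b m)
    & forall n, (n < b ^ m)%N -> num (digit_vec b m n) = n].
Proof.
pose f (n : 'I_(b ^ m)) := digit_vec b m n.
have f_inj : injective f.
  move=> n n' ff; apply: val_inj => /=.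
  rewrite -(from_nth_digit b_gt1 (ltn_ord n)).
  rewrite -(from_nth_digit b_gt1 (ltn_ord n')).
  apply: eq_from_digits => k km; rewrite /nth_digit.
  (* [digit_vec] lists the least significant digit first, [nth_digit] the most significant one, so
     the index is reversed. *)
  have hk : (m - k.+1 < m)%N by rewrite ltn_subrL (leq_trans _ km).
  have := congr1 (fun v : 'cV_m => val (v (Ordinal hk) 0)) ff.
  by rewrite !mxE /= !val_Fp_nat // !modn_mod.
have [|g fK gK] := inj_card_bij f_inj.
  by rewrite card_mx card_Fp // card_ord muln1.
exists (fun v => nat_of_ord (g v)); split=> // n nb.
by rewrite -[n]/(val (Ordinal nb)) -[digit_vec _ _ _]/(f (Ordinal nb)) fK.
Qed.

Lemma net_indexE m (A : 'M['F_b]_m) n :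
  net_index A n = from_digits b m
    (fun k => nat_of_ord ((zero_extend A k *m digit_vec b m n) 0 0)).
Proof.
apply: eq_bigr => k _; congr (nat_of_ord _ * _)%N.
by rewrite /zero_extend valK -row_mul [RHS]mxE (ord1 ord0).
Qed.

Lemma zero_extend_out m (A : 'M['F_b]_m) k : (m <= k)%N -> zero_extend A k = 0.
Proof. by move=> mk; rewrite /zero_extend insubF // ltnNge mk. Qed.

End DigitVec.

(** * One coordinate: blocks of labels and their intervals *)

(** Induction on the number of blocks: [h] lies below the start of the last block or inside it. *)
Lemma sum_block_decomp D (f : 'I_D -> nat) h : (h < \sum_(d < D) f d)%N ->
  exists (d : 'I_D) (k : nat),
    (k < f d)%N /\ h = (\sum_(d' < D | (d' < d)%N) f d' + k)%N.
Proof.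
elim: D f => [|D IHD] f; first by rewrite big_ord0.
rewrite big_ord_recr /=.
have [hlt _|hge hlt] := ltnP h (\sum_(i < D) f (widen_ord (leqnSn D) i)).
  have [d [k [kd ->]]] := IHD (fun i => f (widen_ord (leqnSn D) i)) hlt.
  exists (widen_ord (leqnSn D) d), k; split=> //.
  by rewrite [in RHS]big_mkcond big_ord_recr /= ltnNge (ltnW (ltn_ord d)) /=
    -big_mkcond /= addn0.
exists ord_max, (h - \sum_(i < D) f (widen_ord (leqnSn D) i))%N.
split; first by rewrite ltn_subLR.
rewrite [in RHS]big_mkcond big_ord_recr /= ltnn -big_mkcond /=.
rewrite addn0 (eq_bigl xpredT) => [|i]; first by rewrite subnKC.
exact: ltn_ord.
Qed.

Section LabelledPoints.

Variables (R : realType) (b m D : nat) (j l : 'I_D -> int) (mu : 'I_D -> nat).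
Variable z : nat -> R.
Hypothesis b_gt1 : (1 < b)%N.
Hypothesis J_disjoint :
  trivIset setT (fun d : 'I_D => [set` badic_itv R b (j d) (l d)]).
Hypothesis mu_nonincreasing :
  forall d d' : 'I_D, (d <= d')%N -> (mu d' <= mu d)%N.
Hypothesis mu_sum : (\sum_(d < D) b ^ mu d = b ^ m)%N.
Hypothesis z_def : labelled_points b j l mu z.

Definition block_start (d : 'I_D) : nat :=
  (\sum_(d' < D | (d' < d)%N) b ^ mu d')%N.

(** Each earlier block has length b^(mu d') with mu d' >= mu d, a multiple of b^(mu d). *)
Lemma block_startK d : (block_start d %/ b ^ mu d * b ^ mu d)%N = block_start d.
Proof.
rewrite divnK //; apply: dvdn_sum => d' dd'.
by rewrite dvdn_exp2l // mu_nonincreasing // ltnW.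
Qed.

Lemma block_end d : (block_start d + b ^ mu d <= b ^ m)%N.
Proof.
rewrite -mu_sum [leqRHS](bigID (fun d' : 'I_D => (d' < d)%N)) /= leq_add2l.
by rewrite (bigD1 d) ?ltnn //= leq_addr.
Qed.

Lemma block_div d k : (k < b ^ mu d)%N ->
  ((block_start d + k) %/ b ^ mu d)%N = (block_start d %/ b ^ mu d)%N.
Proof.
move=> kb; rewrite -{1}(block_startK d) divnMDl ?(leq_trans _ kb) //.
by rewrite (divn_small kb) addn0.
Qed.

Lemma in_block d h : (h %/ b ^ mu d)%N = (block_start d %/ b ^ mu d)%N ->
  h = (block_start d + h %% b ^ mu d)%N.
Proof. by move=> hd; rewrite {1}(divn_eq h (b ^ mu d)) hd block_startK. Qed.

Lemma badic_itvE (x : R) d :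
  (x \in badic_itv R b (j d) (l d))
  = (0 <= b%:R ^ (- j d) * x - (l d)%:~R < 1).
Proof.
have bj : 0 < b%:R ^ (- j d) :> R by rewrite exprz_gt0 // ltr0n ltnW.
have bN : b%:R != 0 :> R by rewrite pnatr_eq0 -lt0n ltnW.
rewrite in_itv /= -(ler_pM2l bj) -[X in _ && X](ltr_pM2l bj).
rewrite !mulrA -!expfzDr // addNr expr0z !mul1r subr_ge0 ltrBlDr.
by rewrite rmorphD /= addrC.
Qed.

Lemma labelled_point_coord d k : (k < b ^ mu d)%N ->
  b%:R ^ (- j d) * z (block_start d + k) - (l d)%:~R = k%:R / b%:R ^+ mu d.
Proof.
move=> kb; have bN : b%:R != 0 :> R by rewrite pnatr_eq0 -lt0n ltnW.
rewrite z_def // mulrDr !mulrA -expfzDr // addNr expr0z mul1r.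
rewrite addrAC subrr add0r.
by rewrite mulrAC -expfzDr // addrA addNr add0r mulrC -exprnN.
Qed.

Lemma labelled_point_in d k : (k < b ^ mu d)%N ->
  z (block_start d + k) \in badic_itv R b (j d) (l d).
Proof.
move=> kb; rewrite badic_itvE labelled_point_coord //.
have bmu : 0 < b%:R ^+ mu d :> R by rewrite exprn_gt0 // ltr0n ltnW.
by rewrite divr_ge0 ?ler0n ?ltW //= ltr_pdivrMr // mul1r -natrX ltr_nat.
Qed.

(** A point always lies in the interval of its own block. If it also lies in interval [d],
    disjointness forces its block to be [d]. *)
Lemma labelled_point_inE d h : (h < b ^ m)%N ->
  (z h \in badic_itv R b (j d) (l d))
  = (h %/ b ^ mu d == block_start d %/ b ^ mu d)%N.
Proof.
move=> hb; apply/idP/eqP => [zd|/in_block ->]; last first.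
  by rewrite labelled_point_in // ltn_pmod // expn_gt0 ltnW.
have [|d' [k [kd' hE]]] := @sum_block_decomp D (fun d => b ^ mu d)%N h.
  by rewrite mu_sum.
have dd' : d' = d.
  apply: J_disjoint => //; exists (z h); split=> //=.
  by rewrite hE; apply: labelled_point_in.
by rewrite -dd' hE block_div.
Qed.

Lemma labelled_point_coord_div d h :
  (h %/ b ^ mu d)%N = (block_start d %/ b ^ mu d)%N ->
  b%:R ^ (- j d) * z h - (l d)%:~R = (h %% b ^ mu d)%:R / b%:R ^+ mu d.
Proof.
move=> /in_block hE; rewrite [in LHS]hE labelled_point_coord //.
by rewrite ltn_pmod // expn_gt0 ltnW.
Qed.

End LabelledPoints.

(** * Independence of the rows below the prescribed ones *)

(** Take the first r_i + e_i rows of each matrix, in total (m - M) + (M - t) = m - t, and reorder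
    them so that all prescribed rows come first. *)
Lemma generates_net_rows (b t m M s : nat) (C : 'I_s -> nat -> 'rV['F_b]_m)
    (r e : 'I_s -> nat) :
  generates_net t C -> (t <= M)%N -> (\sum_i r i + M = m)%N ->
  (\sum_i e i = M - t)%N ->
  free ([seq C i k | i <- enum 'I_s, k <- iota 0 (r i)]
        ++ [seq C i (r i + k)%N | i <- enum 'I_s, k <- iota 0 (e i)]).
Proof.
move=> [_ C_free] tM rM eM; have := C_free (fun i => r i + e i)%N.
have -> : (\sum_i (r i + e i) = m - t)%N by rewrite big_split /= eM addnBA ?rM.
move=> /(_ erefl).
congr is_true; apply: perm_free; rewrite perm_sym.
rewrite -(allpairs_mapr (fun i k => C i k) (fun i k => (r i + k)%N)).
have -> : [seq C i k | i <- enum 'I_s, k <- iota 0 (r i + e i)]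
  = [seq C i k | i <- enum 'I_s,
                 k <- iota 0 (r i) ++ [seq (r i + k)%N | k <- iota 0 (e i)]].
  by apply: eq_allpairsr => i; rewrite -iotaDl addn0 iotaD.
by rewrite perm_sym perm_allpairs_catr.
Qed.

Lemma generates_net_section (b t m M s : nat) (C : 'I_s -> nat -> 'rV['F_b]_m)
    (r : 'I_s -> nat) (Z : 'M['F_b]_(m, M)) :
  generates_net t C -> (t <= M)%N -> (\sum_i r i + M = m)%N ->
  (forall w : 'rV_m, w *m Z = 0 ->
     w \in <<[seq C i k | i <- enum 'I_s, k <- iota 0 (r i)]>>%VS) ->
  generates_net t (fun i k => C i (r i + k)%N *m Z).
Proof.
move=> C_net tM rM kerZ; split=> // e eM.
have := free_mulmxr kerZ (generates_net_rows C_net tM rM eM).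
by rewrite map_allpairs.
Qed.
Theorem theorem15 (R : realType) (b s m t : nat)
  (b_prime : prime b) (s_gt0 : (0 < s)%N) (m_gt0 : (0 < m)%N)
  (Delta : 'I_s -> nat)
  (j l : forall i : 'I_s, 'I_(Delta i) -> int)
  (J_disjoint : forall i : 'I_s,
     trivIset setT (fun d : 'I_(Delta i) =>
                      [set` badic_itv R b (j i d) (l i d)]))
  (mu : forall i : 'I_s, 'I_(Delta i) -> nat)
  (mu_le_m : forall (i : 'I_s) (d : 'I_(Delta i)), (mu i d <= m)%N)
  (mu_nonincreasing : forall (i : 'I_s) (d d' : 'I_(Delta i)),
     (d <= d')%N -> (mu i d' <= mu i d)%N)
  (mu_sum : forall i : 'I_s, (\sum_(d < Delta i) b ^ mu i d = b ^ m)%N)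
  (z : 'I_s -> nat -> R)
  (z_def : forall i : 'I_s, labelled_points b (j i) (l i) (mu i) (z i))
  (C : 'I_s -> 'M['F_b]_m)
  (C_net : generates_net t (fun i : 'I_s => zero_extend (C i))) :
  let P := [seq net_point z C n | n <- iota 0 (b ^ m)] in
  forall d : (forall i : 'I_s, 'I_(Delta i)),
  let m_d : int := m%:Z - \sum_(i < s) (m%:Z - (mu i (d i))%:Z) in
  let in_J_d :=
    in_box b (fun i : 'I_s => j i (d i)) (fun i : 'I_s => l i (d i)) in
  t%:Z <= m_d ->
  shifted_digital_net_in_box b t `|m_d|%N
    (fun i : 'I_s => j i (d i)) (fun i : 'I_s => l i (d i))
    [seq x <- P | in_J_d x]
  /\ exists2 x, x \in P & in_J_d x.
Proof.
move=> P d m_d in_J_d t_le_md.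

(* The points of [P] in the chosen box *)
have b_gt1 := prime_gt1 b_prime.
have b_gt0 : (0 < b)%N := ltnW b_gt1.
pose r i := (m - mu i (d i))%N.
pose M := `|m_d|%N.
have rmu i : (r i + mu i (d i))%N = m by rewrite subnK.
have mdM : m_d = M%:Z by rewrite gez0_abs // (le_trans _ t_le_md).
have tM : (t <= M)%N by rewrite -lez_nat -mdM.
have rM : (\sum_i r i + M = m)%N.
  apply/eqP; rewrite -eqz_nat PoszD -mdM /m_d.
  have -> : \sum_(i < s) (m%:Z - (mu i (d i))%:Z) = (\sum_i r i)%N%:Z.
    rewrite (big_morph Posz PoszD (erefl _)); apply: eq_bigr => i _.
    by rewrite subzn.
  by rewrite addrC subrK.
have C_sec := generates_net_rows C_net tM rM.
pose I := [seq (i, k) | i <- enum 'I_s, k <- iota 0 (r i)].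
pose F (p : 'I_s * nat) := zero_extend (C p.1) p.2.
(* [Q i] is the number formed by the [r i] leading digits shared by all labels of the block [d i];
   [a] collects these digits as the right-hand side of the linear system. *)
pose Q i := (block_start b (mu i) (d i) %/ b ^ mu i (d i))%N.
pose a (p : 'I_s * nat) : 'F_b := (nth_digit b (r p.1) (Q p.1) p.2)%:R.
have FI : [seq F p | p <- I]
    = [seq zero_extend (C i) k | i <- enum 'I_s, k <- iota 0 (r i)].
  by rewrite map_allpairs.
have freeI : free [seq F p | p <- I].
  (* Any [e] with sum M - t will do, as only the prescribed rows are kept; all the weight is put on
     coordinate 0. *)
  have [e eM] : exists e : 'I_s -> nat, (\sum_i e i = M - t)%N.
    exists (fun i => if i == Ordinal s_gt0 then (M - t)%N else 0%N).
    by rewrite -big_mkcond big_pred1_eq.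
  by rewrite FI; apply: catl_free (C_sec e eM).
have sizeI : (size I + M)%N = m.
  rewrite size_allpairs_dep sumnE big_map big_enum /= -[RHS]rM.
  by congr (_ + _)%N; apply: eq_bigr => i _; rewrite size_iota.
have [v0 [Z [Z_inj solE kerZ]]] := free_affine_solutions a freeI sizeI.
pose w n i k : nat := (zero_extend (C i) k *m digit_vec b m n) 0 0.
have w_lt n i k : (w n i k < b)%N by apply: ltn_Fp.
have indexE n i : net_index (C i) n = from_digits b (r i + mu i (d i)) (w n i).
  by rewrite rmu net_indexE.
have index_lt n i : (net_index (C i) n < b ^ m)%N.
  by rewrite net_indexE from_digits_lt // => k; apply: ltn_Fp.
have Q_lt i : (Q i < b ^ r i)%N.
  rewrite ltn_divLR ?expn_gt0 ?b_gt0 // -expnD rmu.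
  apply: leq_trans (block_end (mu_sum i) (d i)).
  by rewrite -addn1 leq_add2l expn_gt0 b_gt0.
have blockP n i : (net_index (C i) n %/ b ^ mu i (d i))%N = Q i <->
    forall k, (k < r i)%N -> w n i k = nth_digit b (r i) (Q i) k.
  by rewrite indexE from_digits_div //; apply: from_digitsP.
have point_inE i h : (h < b ^ m)%N ->
    (z i h \in badic_itv R b (j i (d i)) (l i (d i)))
    = (h %/ b ^ mu i (d i) == Q i)%N.
  exact: (labelled_point_inE b_gt1 (J_disjoint i) (@mu_nonincreasing i)
            (mu_sum i) (z_def i) (d i)).
have in_boxP n : reflect (exists u, digit_vec b m n = v0 + Z *m u)
    (in_J_d (net_point z C n)).
  apply: (iffP forallP) => [boxn|/solE soln i].
    apply/solE => _ /allpairsPdep[i [k [_ ki ->]]]; apply: val_inj.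
    rewrite mem_iota /= in ki.
    rewrite /a /= val_Fp_nat // modn_small ?ltn_pmod //.
    apply: (blockP n i).1 ki; apply/eqP.
    by rewrite -point_inE //; have := boxn i; rewrite mxE.
  rewrite mxE point_inE //.
  apply/eqP/blockP => k ki; rewrite /w (soln (i, k)).
    by rewrite /a /= val_Fp_nat // modn_small // ltn_pmod.
  by apply: allpairs_f_dep; rewrite ?mem_enum // mem_iota.
have [num [num_lt numK digitK]] := digit_vec_bij b_prime m.
have [num' [num'_lt num'K digit'K]] := digit_vec_bij b_prime M.
(* [g] enumerates the indices n of the points in the box: the digits of u < b^M parametrize the
   solutions. *)
pose g u := num (v0 + Z *m digit_vec b M u).
have g_in u : in_J_d (net_point z C (g u)).
  by apply/in_boxP; exists (digit_vec b M u); rewrite numK.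
split; last first.
  exists (net_point z C (g 0%N)) => //.
  by apply: map_f; rewrite mem_iota num_lt.
split; first exact: filter_all.
pose J (i : 'I_s) := j i (d i).
pose L (i : 'I_s) := l i (d i).
exists (fun i k => zero_extend (C i) (r i + k)%N *m Z),
  (fun i k => (zero_extend (C i) (r i + k)%N *m v0) 0 0),
  (fun u => box_to_unit b J L (net_point z C (g u))).
split.
- apply: (generates_net_section C_net tM rM) => v.
  by rewrite -FI; apply: kerZ.
- move=> u i _.
  have := g_in u; move=> /forallP/(_ i); rewrite (badic_itvE _ _ b_gt1) => y01.
  split; first by rewrite mxE.
  rewrite !mxE.
  have := g_in u; move=> /forallP/(_ i); rewrite mxE.
  rewrite point_inE //.
  move=> /eqP.
  move=> /(labelled_point_coord_div b_gt1 (@mu_nonincreasing i) (z_def i)) ->.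
  rewrite indexE from_digits_mod //.
  (* The digit vector of [g u] is v0 + Z u, so each remaining digit splits into a part linear in u
     and a shift from [v0]. *)
  rewrite [X in is_expansion _ X](_ : _ = fun k => w (g u) i (r i + k)%N).
    apply: is_expansion_from_digits => // k muk.
    (* For k >= mu the row index r + k is at least m, where the extended matrix is zero. *)
    rewrite /w zero_extend_out ?mul0mx ?mxE //.
    by rewrite -(rmu i) leq_add2l.
  by apply/funext => k; rewrite /w numK mulmxDr mulmxA [in RHS]mxE addrC.
(* The comparison is made on indices n, which are distinct, and then mapped to points, which may
   coincide. *)
- have perm_gen : perm_eq [seq n <- iota 0 (b ^ m) | in_J_d (net_point z C n)]
                            [seq g u | u <- iota 0 (b ^ M)].
    apply: uniq_perm.
    + exact/filter_uniq/iota_uniq.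
    + rewrite map_inj_in_uniq ?iota_uniq // => u u'.
      rewrite !mem_iota => ub u'b /(congr1 (digit_vec b m)).
      by rewrite !numK => /Z_inj /(congr1 num'); rewrite !digit'K.
    + move=> n; rewrite mem_filter mem_iota; apply/andP/mapP.
        move=> [/in_boxP[u nE] nb]; exists (num' u).
          by rewrite mem_iota num'_lt.
        by rewrite /g num'K -nE digitK.
      by move=> [u _ ->]; rewrite g_in num_lt.
  have := perm_map (fun n => box_to_unit b J L (net_point z C n)) perm_gen.
  by rewrite -map_comp filter_map -map_comp.
Qed.
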